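(* Let $\alpha\in(0,1)$. Let $W=(w_{ij})$ be the true matrix of input-output linkages of $n$ firms with all of the data, and let $U$ be the observed matrix of the input-output linkages with data missing. Let $y_{ij}=w_{ij}\mathrm{II}_i$ be the amount of intermediate input use of firm $i$ coming from firm $j$, and let $M$ be such that $y_{ij}\ge M$ for all $i,j$. Suppose that for each $i,j$, the observed data $X_{ij}$ satisfies $X_{ij}\sim\operatorname{Bin}(r,p)$ with $r=y_{ij}$ and $p=1-\zeta$ for some $0<\zeta<1$. If $v_U$ denotes the influence vector calculated with the observed data and $v_W$ denotes the true influence vector, then for all $q\ge1$ and $0<\varepsilon<1$ we have $$\mathbb{P}\left(\|v_U-v_W\|_q\le\frac{2(1-\alpha)\varepsilon}{\alpha(1-\varepsilon)}\right)\ge 1-2n^2e^{-\frac{\varepsilon^2}{3}(1-\zeta)M}.$$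
   Context: An input-output linkage matrix of $n$ firms is a real $n\times n$ matrix $W=(w_{ij})$ with $w_{ij}\ge 0$, $w_{ii}=0$ and $\sum_{j=1}^n w_{ij}=1$ for all $i$; $w_{ij}$ is the share of the intermediate inputs of firm $i$ that come from firm $j$. With $W'$ the transpose of $W$ and $\vec{\mathbf 1}$ the all-ones column vector, the influence vector of $W$ (for the parameter $\alpha$) is $v_W=\frac{\alpha}{n}(I-(1-\alpha)W')^{-1}\vec{\mathbf 1}$. $\mathrm{II}_i$ is the intermediate input use of firm $i$, measured in US dollars. Each dollar of it is observed with probability $1-\zeta$ and is otherwise missing with probability $\zeta$; $X_{ij}$ is the number of observed dollars from the pool of $y_{ij}$ dollars. For example, one can take $M$ to be the minimum of $y_{ij}$ over all $i,j$. The observed matrix is $U=(u_{ij})$ with $u_{ij}=X_{ij}/\sum_{k=1}^nX_{ik}$. $\|v\|_q=(\sum_i|v_i|^q)^{1/q}$. *)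

(* Defs.v *)
From HB Require Import structures.
From mathcomp Require Import all_boot all_order all_algebra.
From mathcomp Require Import all_classical all_reals all_analysis.

Set Implicit Arguments.
Unset Strict Implicit.
Unset Printing Implicit Defensive.

Import Order.TTheory GRing.Theory Num.Theory.

Local Open Scope ring_scope.

Definition linkage_matrix (R : realType) (n : nat) (W : 'M[R]_n) : Prop :=
  [/\ forall i j, 0 <= W i j,
      forall i, W i i = 0 &
      forall i, \sum_j W i j = 1].

(* [invmx] returns its argument on singular matrices; this case does not occur
   when 0 < alpha < 1 and W is nonnegative with row sums at most 1. *)
Definition influence_vector (R : realType) (n : nat) (alpha : R) (W : 'M[R]_n)
    : 'cV[R]_n :=
  (alpha / n%:R) *: (invmx (1%:M - (1 - alpha) *: W^T) *m const_mx 1).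

(* A firm none of whose dollars is observed gets a zero row, since 0 / 0 = 0. *)
Definition observed_matrix (R : realType) (n : nat) (x : 'I_n -> 'I_n -> nat)
    : 'M[R]_n :=
  \matrix_(i, j) ((x i j)%:R / \sum_k (x i k)%:R).

Definition qnorm (R : realType) (n : nat) (q : R) (v : 'cV[R]_n) : R :=
  (\sum_i `|v i 0| `^ q) `^ q^-1.

(* Main.v *)
Require Import Defs.
From HB Require Import structures.
From mathcomp Require Import all_boot all_order all_algebra.
From mathcomp Require Import all_classical all_reals all_analysis.
From mathcomp Require Import ring lra.

Set Implicit Arguments.
Unset Strict Implicit.
Unset Printing Implicit Defensive.

Import Order.TTheory GRing.Theory Num.Theory.
Import numFieldNormedType.Exports.

Local Open Scope classical_set_scope.
Local Open Scope ring_scope.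

(** By Chernoff's inequality each count [X i j] deviates from its mean
    [(1 - zeta) W i j II i] by a relative error greater than [eps] with
    probability at most [2 exp (- eps^2 (1 - zeta) M / 3)]. Off the union of these
    [n^2] events every row of [U - W] has l1-norm at most [2 eps / (1 - eps)].
    Since the rows of [U] and [W] have l1-norm at most 1, the resolvent identity
    [(1 - (1 - alpha) U^T) (v_U - v_W) = (1 - alpha) (U - W)^T v_W]
    bounds the l1-norm of [v_U - v_W], which dominates its q-norm. *)

(** * Chernoff bounds for the binomial distribution *)

(** The difference [h] has derivative [(t - 1) (2 - t) / (3 t^2)], so on []0, 2]] it is minimal at
    [t = 1], where it equals [1/3]. *)
Lemma ln_ge_rational (R : realType) (s : R) :
  0 < s <= 2 -> (s + 1) / 3 - 2 / 3 * s^-1 <= ln s.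
Proof.
move=> /andP[s0 s2].
pose h (t : R) : R := ln t - 3^-1 * t + 2 / 3 * t^-1.
pose dh (t : R) : R := t^-1 - 3^-1 + 2 / 3 * - t ^- 2.
have hd (t : R) : 0 < t -> is_derive t 1 h (dh t).
  move=> t0; have t0' : t != 0 by rewrite gt_eqF.
  have := is_derive1_ln t0; have := is_deriveV t0' (is_derive_id _ _) => ? ?.
  rewrite /h /dh; apply: is_derive_eq.
  by rewrite /GRing.scale/= !mulr1.
have dhE (t : R) : 0 < t -> dh t = (t - 1) * (2 - t) / (3 * t ^+ 2).
  by move=> t0; rewrite /dh; field; rewrite gt_eqF.
have hc a b : 0 < a -> {within `[a, b], continuous h}.
  move=> a0; apply/derivable_within_continuous; move=> t /[!in_itv]/= /andP[ta _].
  have t0 : 0 < t by apply: lt_le_trans ta.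
  by have [] := hd _ t0.
suff : h 1 <= h s by rewrite /h ln1 invr1; lra.
have [s1|/ltW s1] := leP s 1.
- have [|c ccd] := @MVT_segment _ h dh s 1 s1 _ (hc _ _ s0).
    by move=> t; rewrite in_itv/= => /andP[st _]; apply: hd; apply: lt_trans st.
  move: ccd; rewrite in_itv/= => /andP[sc c1].
  have c0 : 0 < c by apply: lt_le_trans sc.
  rewrite -subr_le0 => ->; rewrite dhE// mulr_le0_ge0 ?subr_ge0//.
  rewrite mulr_le0_ge0 ?invr_ge0 ?mulr_ge0 ?(ltW c0)//.
  by rewrite mulr_le0_ge0; lra.
- have [|c ccd] := @MVT_segment _ h dh 1 s s1 _ (hc _ _ ltr01).
    by move=> t; rewrite in_itv/= => /andP[st _]; apply: hd; apply: lt_trans st.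
  move: ccd; rewrite in_itv/= => /andP[sc c1].
  have c0 : 0 < c by apply: lt_le_trans sc.
  rewrite -subr_ge0 => ->; rewrite dhE// mulr_ge0 ?subr_ge0//.
  rewrite mulr_ge0 ?invr_ge0 ?mulr_ge0 ?(ltW c0)//; lra.
Qed.

(** Multiplying the rational bound at [s = 1 + x] by [s] gives exactly [x + x^2 / 3]. Both signs of
    [x] are covered, so both tails get the constant 3. *)
Lemma xlnx_ge_quadratic (R : realType) (x : R) :
  -1 < x <= 1 -> x + x ^+ 2 / 3 <= (1 + x) * ln (1 + x).
Proof.
move=> /andP[x0 x1].
have s0 : 0 < 1 + x by lra.
have s2 : 0 < 1 + x <= 2 by lra.
have := ler_wpM2l (ltW s0) (ln_ge_rational s2); apply: le_trans.
rewrite le_eqVlt; apply/orP; left; apply/eqP; field.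
by rewrite gt_eqF.
Qed.

(** Markov's inequality for the exponential tilt [expR (t * (k - a))]. The sign of [t] is free, so
    [A] may be an upper or a lower tail. *)
Lemma binomial_prob_mgf_le (R : realType) (r : nat) (p t a : R) (A : set nat) :
  0 <= p <= 1 -> (forall k, A k -> t * a <= t * k%:R) ->
  (binomial_prob r p A <= (expR (r%:R * p * (expR t - 1) - t * a))%:E)%E.
Proof.
move=> /andP[p0 p1] hA; rewrite (@binomial_probE _ r p p0 p1).
pose F (k : nat) : R :=
  ((p * expR t) ^+ k * (1 - p) ^+ (r - k)) *+ 'C(r, k) * expR (- (t * a)).
apply: (@le_trans _ _ (\sum_(k < r.+1) (F k)%:E)%E).
  apply: lee_sum => k _; rewrite diracE -EFinM lee_fin /=.
  have pk : 0 <= p ^+ k * (1 - p) ^+ (r - k) *+ 'C(r, k).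
    by rewrite mulrn_wge0// mulr_ge0 ?exprn_ge0 ?subr_ge0.
  have -> : F k = p ^+ k * (1 - p) ^+ (r - k) *+ 'C(r, k) * expR (t * k%:R - t * a).
    rewrite /F expRD expRM_natr exprMn !mulrnAl.
    by rewrite -!mulrA [e in _ * e *+ _ = _]mulrCA.
  apply: ler_wpM2l => //.
  have [/set_mem kA|_] := boolP (nat_of_ord k \in A); last by rewrite expR_ge0.
  by rewrite -[leLHS]expR0 ler_expR subr_ge0 hA.
rewrite sumEFin lee_fin /F -mulr_suml expRD ler_wpM2r ?expR_ge0//.
(* The binomial theorem sums the tilted weights to [(1 - p + p e^t)^r]; then [1 + u <= e^u] is
   applied with [u = p (e^t - 1)]. *)
under eq_bigr do rewrite mulrC.
rewrite -exprDn -mulrA expRM_natl lerXn2r ?nnegrE ?expR_ge0//.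
  by rewrite addr_ge0 ?subr_ge0// mulr_ge0 ?expR_ge0.
by rewrite (le_trans _ (expR_ge1Dx _))//; lra.
Qed.

(* Both tails at once: the upper one for [0 < x], the lower one for [x < 0], each
   with the optimal exponential tilt [ln (1 + x)]. *)
Lemma binomial_prob_tail_le (R : realType) (r : nat) (p x : R) (A : set nat) :
  0 <= p <= 1 -> -1 < x <= 1 ->
  (forall k, A k -> 0 <= x * (k%:R - (1 + x) * (r%:R * p))) ->
  (binomial_prob r p A <= (expR (- (x ^+ 2 / 3 * p * r%:R)))%:E)%E.
Proof.
move=> p01 x11 hA; have [p0 p1] := andP p01; have [x0 x1] := andP x11.
have s0 : 0 < 1 + x by rewrite -ltrBlDl sub0r.
apply: (le_trans (binomial_prob_mgf_le (t := ln (1 + x))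
  (a := (1 + x) * (r%:R * p)) r p01 _)).
  move=> k /hA hk; rewrite -subr_ge0 -mulrBr; move: hk.
  (* The tilt [ln (1 + x)] has the sign of [x], so the hypothesis on [A] transfers to it. *)
  have [xp|xn|<-] := ltgtP 0 x; last by rewrite addr0 ln1 mul0r.
    by rewrite !pmulr_rge0// ln_gt0// ltrDl.
  rewrite !nmulr_rge0// ln_lt0//; apply/andP; split => //.
  by rewrite gtrDl.
have mu0 : 0 <= r%:R * p by rewrite mulr_ge0.
rewrite lee_fin ler_expR lnK//.
have := ler_wpM2l mu0 (xlnx_ge_quadratic x11); lra.
Qed.

Lemma binomial_prob_dev_le (R : realType) (r : nat) (p eps : R) :
  0 <= p <= 1 -> 0 < eps < 1 ->
  (binomial_prob r p [set k | (eps * (r%:R * p) < `|k%:R - r%:R * p|)%R]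
   <= (2 * expR (- (eps ^+ 2 / 3 * p * r%:R)))%:E)%E.
Proof.
move=> p01 /andP[e0 e1]; set mu := r%:R * p.
have -> : [set k | (eps * mu < `|k%:R - mu|)%R] =
    [set k | eps * mu < k%:R - mu] `|` [set k | eps * mu < mu - k%:R].
  apply/seteqP; split => k /=; rewrite lter_normr opprB.
    by move=> /orP.
  by move=> /orP.
apply: (le_trans (measureU2 (binomial_prob r p) _ _)) => //.
rewrite mulr_natl mulr2n EFinD; apply: leeD.
  apply: binomial_prob_tail_le => //; first by lra.
  by move=> k /= h; rewrite mulr_ge0 ?(ltW e0)// -/mu; lra.
(* The lower tail is the case [x = - eps]. *)
rewrite -sqrrN; apply: binomial_prob_tail_le => //; first by lra.
move=> k /= h; rewrite -/mu mulr_le0 ?oppr_le0 ?(ltW e0)//; lra.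
Qed.

Lemma binomial_prob0 (R : realType) (p : R) (A : set nat) :
  0 <= p <= 1 -> binomial_prob 0 p A = ((0%N \in A)%:R)%:E.
Proof.
move=> /andP[p0 p1]; rewrite (@binomial_probE _ 0 p p0 p1) big_ord1 /=.
by rewrite !expr0 mulr1 mul1e diracE.
Qed.

(** * Union bound and measurability *)

Lemma measure_bigsetU_le (d : measure_display) (T : measurableType d)
    (R : realType) (mu : {measure set T -> \bar R}) (I : Type)
    (s : seq I) (F : I -> set T) :
  (forall i, measurable (F i)) ->
  (mu (\big[setU/set0]_(i <- s) F i) <= \sum_(i <- s) mu (F i))%E.
Proof.
move=> mF; elim: s => [|i s IHs]; first by rewrite !big_nil measure0.
rewrite !big_cons (le_trans (measureU2 _ _ _))//.
  by apply: bigsetU_measurable.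
by rewrite leeD2l.
Qed.

(** A finite family of counts takes countably many values, so the event is a countable union of
    finite intersections of preimages, whatever [Q] is. No regularity of the influence vector has to
    be proved. *)
Lemma measurable_family_preimage (d : measure_display) (T : measurableType d) (I : finType)
    (X : I -> {mfun T >-> nat}) (Q : (I -> nat) -> Prop) :
  measurable [set w | Q (fun i => X i w)].
Proof.
rewrite [X in measurable X](_ : _ = \bigcup_(x : {ffun I -> nat})
    (if `[< Q x >] then \bigcap_(i in [set: I]) (X i @^-1` [set x i]) else set0)).
  apply: countable_bigcupT_measurable => [|x]; first exact: countableP.
  case: ifP => // _; apply: fin_bigcap_measurable; first exact: finite_finset.
  by move=> i _; rewrite -[X in measurable X]setTI; apply: measurable_funPT.
apply/seteqP; split => [w Qw|w [x _]].
  exists [ffun i => X i w] => //.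
  have -> : ([ffun i => X i w] : I -> nat) = fun i => X i w.
    by apply/funext => i; rewrite ffunE.
  by rewrite asboolT.
case: ifPn => // /asboolP Qx hw /=.
suff -> : (fun i => X i w) = x by [].
by apply/funext => i; apply: hw.
Qed.

(** * Norm inequalities and the resolvent *)

Lemma qnorm_le_norm1 (R : realType) (n : nat) (q : R) (v : 'cV[R]_n) :
  1 <= q -> qnorm q v <= \sum_i `|v i 0|.
Proof.
move=> q1; have q0 : 0 < q by apply: lt_le_trans q1.
rewrite /qnorm; set s := \sum_i `|v i 0|.
have s0 : 0 <= s by apply: sumr_ge0.
have le_pow : \sum_i `|v i 0| `^ q <= s `^ q.
  (* Termwise, [|v i|^q = |v i| |v i|^(q-1) <= |v i| s^(q-1)]. *)
  rewrite -(mulr_powRB1 s0 q0) {1}/s mulr_suml; apply: ler_sum => i _.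
  rewrite -(mulr_powRB1 (normr_ge0 _) q0) ler_wpM2l//.
  apply: ge0_ler_powR; rewrite ?subr_ge0 ?nnegrE//.
  by rewrite /s (bigD1 i)//= lerDl sumr_ge0.
have -> : s = (s `^ q) `^ q^-1.
  by rewrite -powRrM mulfV ?gt_eqF// powRr1.
apply: ge0_ler_powR; rewrite ?nnegrE ?invr_ge0 ?powR_ge0// ?(ltW q0)//.
by apply: sumr_ge0 => i _; apply: powR_ge0.
Qed.

Lemma norm1_mul_tr_le (R : realDomainType) (m n : nat) (delta : R)
    (A : 'M[R]_(m, n)) (v : 'cV[R]_m) :
  (forall i, \sum_j `|A i j| <= delta) ->
  \sum_j `|(A^T *m v) j 0| <= delta * \sum_i `|v i 0|.
Proof.
move=> hA.
have -> : delta * \sum_i `|v i 0| = \sum_i delta * `|v i 0| by rewrite mulr_sumr.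
apply: (@le_trans _ _ (\sum_j \sum_i `|A i j| * `|v i 0|)).
  apply: ler_sum => j _; rewrite mxE (le_trans (ler_norm_sum _ _ _))//.
  by apply: ler_sum => i _; rewrite mxE normrM.
rewrite exchange_big/=; apply: ler_sum => i _.
by rewrite -mulr_suml ler_wpM2r.
Qed.

(** By the reverse triangle inequality, since [A^T] does not increase the l1-norm. This gives both
    invertibility and the norm bounds below. *)
Lemma norm1_le_resolvent (R : realDomainType) (n : nat) (alpha : R) (A : 'M[R]_n)
    (v : 'cV[R]_n) :
  alpha <= 1 -> (forall i, \sum_j `|A i j| <= 1) ->
  alpha * \sum_i `|v i 0| <=
  \sum_i `|((1%:M - (1 - alpha) *: A^T) *m v) i 0|.
Proof.
move=> a1 hA; have := norm1_mul_tr_le v hA; rewrite mul1r.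
set N := \sum_i `|v i 0|; set NA := \sum_j _ => leN.
suff : N - (1 - alpha) * NA <= \sum_i `|((1%:M - (1 - alpha) *: A^T) *m v) i 0|.
  by apply: le_trans; rewrite -subr_ge0; nra.
rewrite /N /NA mulr_sumr -sumrB; apply: ler_sum => i _.
rewrite mulmxBl mul1mx -scalemxAl.
rewrite [leRHS](_ : _ = `|v i 0 - (1 - alpha) * (A^T *m v) i 0|); last first.
  by rewrite !mxE.
by rewrite (le_trans _ (lerB_dist _ _))// normrM ger0_norm// subr_ge0.
Qed.

Lemma resolvent_unitmx (R : realFieldType) (n : nat) (alpha : R) (A : 'M[R]_n) :
  0 < alpha <= 1 -> (forall i, \sum_j `|A i j| <= 1) ->
  1%:M - (1 - alpha) *: A^T \in unitmx.
Proof.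
move=> /andP[a0 a1] hA; rewrite -unitmx_tr -row_free_unit; apply: inj_row_free => v.
set B := _ - _ => vB.
have Bv : B *m v^T = 0 by apply: trmx_inj; rewrite trmx_mul trmxK vB trmx0.
have := norm1_le_resolvent v^T a1 hA; rewrite -/B Bv.
rewrite [leRHS]big1 => [|i _]; last by rewrite mxE normr0.
rewrite pmulr_rle0// => le0.
have /eqP : \sum_i `|v^T i 0| = 0 by apply/eqP; rewrite eq_le le0 sumr_ge0.
rewrite psumr_eq0// => /allP v0; apply/rowP => i.
by have := v0 i (mem_index_enum _); rewrite /= normr_eq0 !mxE => /eqP.
Qed.

(** Replaces [invmx] by the linear system that characterizes the influence vector. *)
Lemma influence_vectorE (R : realType) (n : nat) (alpha : R) (A : 'M[R]_n) :
  0 < alpha <= 1 -> (forall i, \sum_j `|A i j| <= 1) ->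
  (1%:M - (1 - alpha) *: A^T) *m influence_vector alpha A
    = const_mx (alpha / n%:R).
Proof.
move=> a01 hA; rewrite /influence_vector -scalemxAr mulmxA.
rewrite mulmxV ?resolvent_unitmx// mul1mx.
by apply/matrixP => i j; rewrite !mxE mulr1.
Qed.

Lemma norm1_influence_vector_le (R : realType) (n : nat) (alpha : R)
    (A : 'M[R]_n) :
  0 < alpha <= 1 -> (forall i, \sum_j `|A i j| <= 1) ->
  \sum_i `|influence_vector alpha A i 0| <= 1.
Proof.
move=> a01 hA; have [a0 a1] := andP a01.
have := norm1_le_resolvent (influence_vector alpha A) a1 hA.
rewrite influence_vectorE//.
under [leRHS]eq_bigr do rewrite mxE.
rewrite sumr_const card_ord -[leRHS]mulr_natr => h.
rewrite -(ler_pM2l a0) mulr1 (le_trans h)//.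
rewrite ger0_norm ?divr_ge0 ?(ltW a0)//.
have [->|n0] := eqVneq n 0%N; first by rewrite mulr0 ltW.
by rewrite divfK// pnatr_eq0.
Qed.

Lemma norm1_influence_vectorB_le (R : realType) (n : nat) (alpha delta : R)
    (U W : 'M[R]_n) :
  0 < alpha <= 1 -> 0 <= delta ->
  (forall i, \sum_j `|U i j| <= 1) -> (forall i, \sum_j `|W i j| <= 1) ->
  (forall i, \sum_j `|U i j - W i j| <= delta) ->
  \sum_i `|(influence_vector alpha U - influence_vector alpha W) i 0|
    <= (1 - alpha) * delta / alpha.
Proof.
move=> a01 d0 hU hW hUW; have [a0 a1] := andP a01.
set u := influence_vector alpha U; set w := influence_vector alpha W.
have eqn : (1%:M - (1 - alpha) *: U^T) *m (u - w)
    = (1 - alpha) *: ((U - W)^T *m w).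
  (* Both linear systems have the same constant right-hand side, so the one for [W] can be
     substituted into the one for [U]. *)
  rewrite mulmxBr influence_vectorE// -(influence_vectorE a01 hW) -/w.
  rewrite !mulmxBl !mul1mx -!scalemxAl (linearB (@trmx _ _ _))/= [in RHS]mulmxBl.
  by rewrite scalerBr opprB addrC addrA subrK.
rewrite ler_pdivlMr// mulrC.
apply: (le_trans (norm1_le_resolvent (u - w) a1 hU)); rewrite eqn.
under eq_bigr do rewrite mxE normrM ger0_norm ?subr_ge0//.
rewrite -mulr_sumr ler_wpM2l ?subr_ge0//.
have hUW' i : \sum_j `|(U - W) i j| <= delta.
  by under eq_bigr do rewrite !mxE; apply: hUW.
rewrite (le_trans (norm1_mul_tr_le w hUW'))//.
by rewrite ler_piMr// norm1_influence_vector_le.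
Qed.

(** * From accurate counts to an accurate observed matrix *)

Lemma observed_matrix_norm1_le (R : realType) (n : nat)
    (x : 'I_n -> 'I_n -> nat) (i : 'I_n) :
  \sum_j `|observed_matrix R x i j| <= 1.
Proof.
have S0 : 0 <= \sum_k ((x i k)%:R : R) by apply: sumr_ge0.
under eq_bigr do rewrite mxE ger0_norm ?divr_ge0//.
rewrite -mulr_suml.
(* A wholly unobserved row is zero; any other row sums to exactly 1. *)
have [->|S1] := eqVneq (\sum_k ((x i k)%:R : R)) 0; first by rewrite mul0r.
by rewrite mulfV.
Qed.

(* If each count is within a factor [1 +- eps] of [c i * W i j], so is their sum
   of [c i]; hence [x - S W], with [S] the row sum, is at most [2 eps c W]. *)
Lemma observed_matrix_dist_le (R : realType) (n : nat) (eps : R) (W : 'M[R]_n)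
    (c : 'I_n -> R) (x : 'I_n -> 'I_n -> nat) :
  0 < eps < 1 -> linkage_matrix W -> (forall i, 0 < c i) ->
  (forall i j, `|(x i j)%:R - c i * W i j| <= eps * (c i * W i j)) ->
  forall i, \sum_j `|observed_matrix R x i j - W i j| <= 2 * eps / (1 - eps).
Proof.
move=> /andP[e0 e1] [W0 _ W1] c0 hx i.
set S := \sum_k ((x i k)%:R : R).
have dS : `|S - c i| <= eps * c i.
  have -> : S - c i = \sum_j ((x i j)%:R - c i * W i j).
    by rewrite sumrB -mulr_sumr W1 mulr1.
  rewrite (le_trans (ler_norm_sum _ _ _))//.
  rewrite (le_trans (ler_sum _ (fun j _ => hx i j)))//.
  by rewrite -!mulr_sumr W1 mulr1.
have ci := c0 i.
have leS : (1 - eps) * c i <= S by move: dS; rewrite ler_norml => /andP[]; lra.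
have S0 : 0 < S by apply: lt_le_trans leS; rewrite mulr_gt0// subr_gt0.
have -> : 2 * eps / (1 - eps) = \sum_j 2 * eps / (1 - eps) * W i j.
  by rewrite -mulr_sumr W1 mulr1.
apply: ler_sum => j _.
rewrite mxE -/S.
have -> : (x i j)%:R / S - W i j
    = (((x i j)%:R - c i * W i j) - (S - c i) * W i j) / S.
  by field; rewrite gt_eqF.
rewrite normrM normfV (gtr0_norm S0) ler_pdivrMr//.
have Wij := W0 i j.
apply: (@le_trans _ _ (2 * eps * W i j * c i)).
  rewrite (le_trans (ler_normB _ _))// normrM (ger0_norm Wij).
  have := hx i j; have := ler_wpM2r Wij dS; lra.
have e1' : 0 < 1 - eps by rewrite subr_gt0.
have k0 : 0 <= 2 * eps * W i j / (1 - eps).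
  by rewrite divr_ge0 ?mulr_ge0 ?(ltW e0) ?(ltW e1').
(* Dividing by [S >= (1 - eps) c i] produces the denominator [1 - eps]. *)
have := ler_wpM2l k0 leS.
rewrite [leLHS](_ : _ = 2 * eps * W i j * c i); last by field; rewrite gt_eqF.
by rewrite [leRHS](_ : _ = 2 * eps / (1 - eps) * W i j * S)//; ring.
Qed.

(* Since W i i = 0, the lower bound M on the pools y i j is only meaningful,
   and only required, for pairs of distinct firms. *)
Theorem theorem6p1 (R : realType) (d : measure_display) (T : measurableType d)
    (P : probability T R) (n : nat) (alpha zeta M : R)
    (W : 'M[R]_n) (II : 'I_n -> R)
    (y : 'I_n -> 'I_n -> nat) (X : 'I_n -> 'I_n -> {RV P >-> nat})
    (halpha : 0 < alpha < 1) (hzeta : 0 < zeta < 1)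
    (hW : linkage_matrix W)
    (hy : forall i j, (y i j)%:R = W i j * II i)
    (hM : forall i j : 'I_n, i != j -> M <= (y i j)%:R)
    (hX : forall i j (A : set nat),
        distribution P (X i j) A = binomial_prob (y i j) (1 - zeta) A)
    (q eps : R) (hq : 1 <= q) (heps : 0 < eps < 1) :
  ((1 - 2 * n%:R ^+ 2 * expR (- (eps ^+ 2 / 3 * (1 - zeta) * M)))%:E <=
   P [set w | (qnorm q (influence_vector alpha
                         (observed_matrix R (fun i j => X i j w)) -
                       influence_vector alpha W)
              <= 2 * (1 - alpha) * eps / (alpha * (1 - eps)))%R])%E.
Proof.
have [[[a0 a1] [z0 z1]] [e0 e1]] := (andP halpha, andP hzeta, andP heps).
have [W0 Wii W1] := hW.
set E := [set w | _].
have mE : measurable E.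
  exact: (measurable_family_preimage (fun ij => X ij.1 ij.2)
    (fun x => (qnorm q (influence_vector alpha
                         (observed_matrix R (fun i j => x (i, j))) -
                       influence_vector alpha W)
              <= 2 * (1 - alpha) * eps / (alpha * (1 - eps)))%R)).
(* If [M <= 0] and there is a firm, the exponential is at least 1 and the claimed lower bound is at
   most 0. *)
have [[n0 M0]|pos] : (n != 0%N /\ M <= 0) \/ (n != 0%N -> 0 < M).
  have [_|n0] := eqVneq n 0%N; first by right.
  by have [M0|M0] := leP M 0; [left|right].
  apply: (le_trans _ (measure_ge0 P E)); rewrite lee_fin subr_le0.
  have K1 : 1 <= expR (- (eps ^+ 2 / 3 * (1 - zeta) * M)).
    rewrite -[leLHS]expR0 ler_expR oppr_ge0 mulr_ge0_le0//.
    by rewrite !mulr_ge0 ?subr_ge0 ?ltW.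
  have n1 : 1 <= n%:R ^+ 2 :> R by rewrite exprn_ege1// ler1n lt0n.
  have n2 : 1 <= 2 * n%:R ^+ 2 :> R by lra.
  by rewrite -[leLHS]mulr1 ler_pM.
(* Row [i] sums to 1 with zero diagonal, so some [j != i] has [W i j > 0]; then
   [W i j * II i >= M > 0]. *)
have II0 i : 0 < II i.
  have M0 : 0 < M by apply: pos; apply/eqP => n0; move: i; rewrite n0 => -[].
  have [/forallP Wi0|] := boolP [forall j, W i j == 0].
    have := W1 i; rewrite big1 => [/eqP|j _]; last exact/eqP.
    by rewrite eq_sym oner_eq0.
  rewrite negb_forall => /existsP[j Wij].
  have ij : i != j by apply: contraNneq Wij => <-; rewrite Wii.
  have := lt_le_trans M0 (hM i j ij).
  by rewrite hy pmulr_rgt0// lt_neqAle eq_sym Wij W0.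
set p := 1 - zeta in hX *.
have p0 : 0 < p by rewrite subr_gt0.
have p01 : 0 <= p <= 1 by rewrite ltW//= /p gerBl ltW.
pose far i j := [set k : nat |
  (eps * ((y i j)%:R * p) < `|k%:R - (y i j)%:R * p|)%R].
pose bad (ij : 'I_n * 'I_n) := X ij.1 ij.2 @^-1` far ij.1 ij.2.
pose K := 2 * expR (- (eps ^+ 2 / 3 * p * M)).
have mbad ij : measurable (bad ij).
  by rewrite -[X in measurable X]setTI; apply: measurable_funPT.
have Pbad ij : (P (bad ij) <= K%:E)%E.
  case: ij => i j.
  rewrite -[P _]/(distribution P (X i j) (far i j)) hX.
  (* A diagonal pool is empty: its count is 0 almost surely, and 0 is not in [far i i] because the
     inequality there is strict. *)
  have [<-|ij] := eqVneq i j.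
    have yii : y i i = 0%N by apply/eqP; rewrite -(eqr_nat R) hy Wii mul0r.
    rewrite /far yii binomial_prob0// memNset/=.
      by rewrite lee_fin mulr_ge0// expR_ge0.
    by rewrite !mul0r mulr0 subr0 normr0 ltxx.
  apply: (le_trans (binomial_prob_dev_le _ p01 heps)).
  rewrite lee_fin ler_pM2l// ler_expR lerN2 ler_wpM2l ?hM//.
  by rewrite !mulr_ge0// ltW.
pose B := \big[setU/set0]_ij bad ij.
have mB : measurable B by apply: bigsetU_measurable.
have goodE : ~` B `<=` E.
  move=> w nBw.
  have d0 : 0 <= 2 * eps / (1 - eps) by rewrite divr_ge0 ?mulr_ge0 ?subr_ge0 ?ltW.
  rewrite /E /= (le_trans (qnorm_le_norm1 _ hq))//.
  have -> : 2 * (1 - alpha) * eps / (alpha * (1 - eps))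
      = (1 - alpha) * (2 * eps / (1 - eps)) / alpha.
    by field; rewrite !gt_eqF ?subr_gt0.
  apply: norm1_influence_vectorB_le => //; first by rewrite a0 ltW.
  - exact: observed_matrix_norm1_le.
  - by move=> i; under eq_bigr do rewrite ger0_norm//; rewrite W1.
  (* With [c i = p * II i], the product [c i * W i j] is the mean of [X i j]. *)
  apply: (observed_matrix_dist_le (c := fun i => p * II i)) => // [i|i j].
    by rewrite mulr_gt0.
  have -> : p * II i * W i j = (y i j)%:R * p by rewrite hy; ring.
  rewrite leNgt; apply/negP => farw; apply: nBw.
  by rewrite /B -bigcup_seq; exists (i, j) => //=; rewrite mem_index_enum.
apply: (@le_trans _ _ (P (~` B))); last first.
  by apply: le_measure; rewrite ?inE//; apply: measurableC.
rewrite probability_setC// EFinB leeB// (le_trans (measure_bigsetU_le _ _ _))//.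
apply: (le_trans (lee_sum _ (fun ij _ => Pbad ij))).
(* The union bound runs over all [n^2] ordered pairs, each costing [K]. *)
rewrite sumEFin lee_fin sumr_const card_prod card_ord.
rewrite -[leLHS]mulr_natr natrM /K -expr2.
by rewrite mulrAC.
Qed.
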